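(* Let $n\ge 0$ be an integer. The identification $f_B\leftrightarrow b_{i(B)}$, $B\subseteq\{1,2,\dots,n\}$ (extended $\mathbb{R}$-linearly), is an isomorphism of real algebras between $K_{n,0}$ and $\mathbb{R}^{2^n}$.
   Context: $K_{n,0}$ is the real associative algebra with unity generated by $e_1,\dots,e_n$ subject to $e_i^2=1$ and $e_ie_j=e_je_i$ for all $i,j\in\{1,\dots,n\}$. For $A=\{i_1<\cdots<i_l\}\subseteq\{1,\dots,n\}$ put $e_A:=e_{i_1}\cdots e_{i_l}$, with $e_{\{\}}:=1$; the elements $e_A$, $A\subseteq\{1,\dots,n\}$, form a basis of $K_{n,0}$ as a real vector space (dimension $2^n$). Operations of conjugation: for $l\in\{1,\dots,n\}$, $U\mapsto U^{(l)}$ is the linear map on $K_{n,0}$ replacing the generator $e_l$ by $-e_l$, i.e. $e_A^{(l)}=-e_A$ if $l\in A$ and $e_A^{(l)}=e_A$ if $l\notin A$. For $B=\{i_1,\dots,i_k\}\subseteq\{1,\dots,n\}$, $U^{(B)}$ denotes the result of applying the conjugations $(i_1),\dots,(i_k)$ successively (they commute), with $U^{(\{\})}:=U$. Define $f:=\frac{1}{2^n}\sum_{A\subseteq\{1,\dots,n\}}e_A\in K_{n,0}$ and $f_B:=f^{(B)}$ for $B\subseteq\{1,\dots,n\}$. Arrange the subsets of $\{1,\dots,n\}$ in lexicographic order and enumerate them, the empty set being the first; $i(B)\in\{1,\dots,2^n\}$ denotes the index of $B$ in this enumeration (so $i$ is a bijection from the set of subsets of $\{1,\dots,n\}$ to $\{1,\dots,2^n\}$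 with $i(\{\})=1$). $\mathbb{R}^{2^n}$ is the direct sum of $2^n$ copies of the algebra $\mathbb{R}$ with coordinatewise multiplication, and $b_k\in\mathbb{R}^{2^n}$ is the tuple with $1$ in the $k$-th position and $0$ elsewhere. *)

(* Defs.v *)
From HB Require Import structures.
From mathcomp Require Import all_boot all_order all_algebra.
From mathcomp Require Import reals.

Set Implicit Arguments.
Unset Strict Implicit.
Unset Printing Implicit Defensive.

Import Order.TTheory GRing.Theory Num.Theory.
Local Open Scope ring_scope.

Definition symd (n : nat) (A B : {set 'I_n}) : {set 'I_n} :=
  [set i | (i \in A) (+) (i \in B)].

Lemma symdA (n : nat) : associative (@symd n).
Proof. by move=> A B C; apply/setP => i; rewrite !inE addbA. Qed.

Lemma symdC (n : nat) : commutative (@symd n).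
Proof. by move=> A B; apply/setP => i; rewrite !inE addbC. Qed.

Lemma symdK (n : nat) (A : {set 'I_n}) : involutive (symd A).
Proof. by move=> B; apply/setP => i; rewrite !inE addKb. Qed.

Lemma symdKr (n : nat) (A : {set 'I_n}) : involutive (fun B => symd B A).
Proof. by move=> B; rewrite symdC (symdC B) symdK. Qed.

Lemma symd0 (n : nat) (A : {set 'I_n}) : symd set0 A = A.
Proof. by apply/setP => i; rewrite !inE. Qed.

Lemma symd_eq0 (n : nat) (A B : {set 'I_n}) : (symd A B == set0) = (A == B).
Proof.
apply/eqP/eqP => [AB0|->]; last by apply/setP => i; rewrite !inE addbb.
by rewrite -(symdKr B A) AB0 symd0.
Qed.

(* The algebra K_{n,0}, 'I_n standing for {1, ..., n}: an element U is given
   by its coordinates U A in the basis (e_A).  Since e_i^2 = 1 and the e_i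
   commute, e_A e_B = e_(A symd B), whence the product below.
   [Kn0_presentation] shows that this is the algebra generated by the e_i
   subject to these relations. *)
Definition Kn0 (R : realType) (n : nat) : Type := {ffun {set 'I_n} -> R^o}.

HB.instance Definition _ (R : realType) (n : nat) :=
  GRing.Lmodule.on (Kn0 R n).

Definition Kn0_basis (R : realType) (n : nat) (A : {set 'I_n}) : Kn0 R n :=
  [ffun B => (B == A)%:R].

Definition Kn0_mul (R : realType) (n : nat) (U V : Kn0 R n) : Kn0 R n :=
  [ffun C => \sum_A U A * V (symd A C)].

Fact Kn0_mulC (R : realType) (n : nat) : commutative (@Kn0_mul R n).
Proof.
move=> U V; apply/ffunP => C; rewrite !ffunE.
rewrite (reindex_inj (inv_inj (symdKr C))) /=.
by apply: eq_bigr => A _; rewrite symdKr mulrC.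
Qed.

Fact Kn0_mulA (R : realType) (n : nat) : associative (@Kn0_mul R n).
Proof.
move=> U V W; apply/ffunP => C; rewrite !ffunE.
under eq_bigr => A _ do rewrite ffunE mulr_sumr.
under [RHS]eq_bigr => A _ do rewrite ffunE mulr_suml.
rewrite [RHS]exchange_big /=; apply: eq_bigr => A _.
rewrite [RHS](reindex_inj (inv_inj (symdK A))) /=.
by apply: eq_bigr => B _; rewrite symdK mulrA symdA (symdC B).
Qed.

Fact Kn0_mul1l (R : realType) (n : nat) :
  left_id (Kn0_basis R set0) (@Kn0_mul R n).
Proof.
move=> U; apply/ffunP => C; rewrite !ffunE (bigD1 set0) //= ffunE eqxx mul1r.
rewrite symd0 big1 ?addr0 // => A /negbTE A0.
by rewrite ffunE A0 mul0r.
Qed.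

Fact Kn0_mulDl (R : realType) (n : nat) :
  left_distributive (@Kn0_mul R n) +%R.
Proof.
move=> U V W; apply/ffunP => C; rewrite !ffunE -big_split /=.
by apply: eq_bigr => A _; rewrite ffunE mulrDl.
Qed.

Fact Kn0_one_neq0 (R : realType) (n : nat) :
  Kn0_basis R set0 != 0 :> Kn0 R n.
Proof. by apply/eqP => /ffunP/(_ set0)/eqP; rewrite !ffunE eqxx oner_eq0. Qed.

HB.instance Definition _ (R : realType) (n : nat) :=
  GRing.Zmodule_isComNzRing.Build (Kn0 R n) (@Kn0_mulA R n) (@Kn0_mulC R n)
    (@Kn0_mul1l R n) (@Kn0_mulDl R n) (@Kn0_one_neq0 R n).

Fact Kn0_scaleAl (R : realType) (n : nat) (a : R) (U V : Kn0 R n) :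
  a *: (U * V) = (a *: U) * V.
Proof.
apply/ffunP => C; rewrite !ffunE scaler_sumr.
by apply: eq_bigr => A _; rewrite ffunE /= scalerAl.
Qed.

HB.instance Definition _ (R : realType) (n : nat) :=
  GRing.Lmodule_isLalgebra.Build R (Kn0 R n) (@Kn0_scaleAl R n).
HB.instance Definition _ (R : realType) (n : nat) :=
  GRing.Lalgebra_isComAlgebra.Build R (Kn0 R n).

Definition gen (R : realType) (n : nat) (i : 'I_n) : Kn0 R n :=
  Kn0_basis R [set i].

Definition eA (R : realType) (n : nat) (A : {set 'I_n}) : Kn0 R n :=
  \prod_(i in A) gen R i.

Lemma Kn0_basisM (R : realType) (n : nat) (A B : {set 'I_n}) :
  Kn0_basis R A * Kn0_basis R B = Kn0_basis R (symd A B).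
Proof.
apply/ffunP => C; rewrite !ffunE (bigD1 A) //= !ffunE eqxx mul1r.
rewrite big1 ?addr0 => [|D /negbTE AD]; last by rewrite !ffunE AD mul0r.
congr (_ %:R); congr nat_of_bool.
by apply/eqP/eqP => [<-|->]; rewrite symdK.
Qed.

Lemma gen_sq (R : realType) (n : nat) (i : 'I_n) : gen R i * gen R i = 1.
Proof.
rewrite Kn0_basisM; suff /eqP -> : symd [set i] [set i] == set0 by [].
by rewrite symd_eq0.
Qed.

Lemma eAE (R : realType) (n : nat) (A : {set 'I_n}) : eA R A = Kn0_basis R A.
Proof.
have [m] := ubnP #|A|; elim: m A => // m IH A.
have [->|[i iA]] := set_0Vmem A; first by rewrite /eA big_set0.
rewrite (cardsD1 i A) iA ltnS => Am.
rewrite /eA (big_setD1 i iA) /= -/(eA R (A :\ i)) IH // Kn0_basisM.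
congr Kn0_basis; apply/setP => j; rewrite !inE.
by case: eqVneq => //= ->; rewrite iA.
Qed.

Lemma eA_decomp (R : realType) (n : nat) (U : Kn0 R n) :
  U = \sum_A (U A : R) *: eA R A.
Proof.
apply/ffunP => C; rewrite sum_ffunE (bigD1 C) //= eAE !ffunE eqxx.
rewrite big1 ?addr0 => [|D /negbTE CD]; first by rewrite [RHS]mulr1.
by rewrite eAE !ffunE eq_sym CD scaler0.
Qed.

Lemma prod_comm (S : pzSemiRingType) (I : finType) (g h : I -> S) :
  (forall i j, GRing.comm (g i) (h j)) ->
  (\prod_i g i) * (\prod_i h i) = \prod_i (g i * h i).
Proof.
move=> gh; elim: (index_enum I) => [|i s IH]; first by rewrite !big_nil mulr1.
rewrite !big_cons -IH -!mulrA; congr (_ * _); rewrite !mulrA; congr (_ * _).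
by apply/commr_sym; apply: commr_prod => j _; apply/commr_sym/gh.
Qed.

Lemma Kn0_presentation (R : realType) (n : nat) (S : algType R)
    (g : 'I_n -> S) (gsq : forall i, g i * g i = 1)
    (gC : forall i j, g i * g j = g j * g i) :
  exists phi : {lrmorphism Kn0 R n -> S},
    (forall i, phi (gen R i) = g i) /\
    (forall psi : {lrmorphism Kn0 R n -> S},
       (forall i, psi (gen R i) = g i) -> psi =1 phi).
Proof.
pose gA (A : {set 'I_n}) : S := \prod_i (if i \in A then g i else 1).
pose phi (U : Kn0 R n) : S := \sum_A (U A : R) *: gA A.
have gAM A B : gA A * gA B = gA (symd A B).
  rewrite /gA prod_comm => [|i j].
    apply: eq_bigr => i _; rewrite inE.
    by case: (i \in A); case: (i \in B) => /=; rewrite ?mulr1 ?mul1r.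
  rewrite /GRing.comm; case: ifP => _; case: ifP => _;
    by rewrite ?mulr1 ?mul1r.
have phiB A : phi (Kn0_basis R A) = gA A.
  rewrite /phi (bigD1 A) //= ffunE eqxx scale1r.
  rewrite big1 ?addr0 // => B /negbTE AB.
  by rewrite ffunE AB scale0r.
have gA1 i : gA [set i] = g i.
  rewrite /gA -(big_mkcond (fun j => j \in [set i])) /=.
  by rewrite big_set1.
have gA0 : gA set0 = 1 by rewrite /gA big1 // => i _; rewrite inE.
have phi_lin : linear phi.
  move=> a U V; rewrite /phi scaler_sumr -big_split /=.
  by apply: eq_bigr => A _; rewrite !ffunE scalerDl scalerA.
have phi_mul : monoid_morphism phi.
  split=> [|U V]; first by rewrite phiB.
  rewrite /phi; under eq_bigr => C _ do rewrite ffunE scaler_suml.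
  rewrite exchange_big mulr_suml /=; apply: eq_bigr => A _.
  rewrite mulr_sumr (reindex_inj (inv_inj (symdK A))) /=.
  apply: eq_bigr => B _.
  by rewrite symdK -gAM -scalerAl -scalerAr scalerA.
pose Phi : {lrmorphism Kn0 R n -> S} := HB.pack phi
  (GRing.isLinear.Build R (Kn0 R n) S _ phi phi_lin)
  (GRing.isMonoidMorphism.Build (Kn0 R n) S phi phi_mul).
exists Phi; split=> [i|psi psig U]; first by rewrite /= phiB gA1.
rewrite (eA_decomp U) !linear_sum; apply: eq_bigr => A _.
rewrite !linearZ /=; congr (_ *: _).
rewrite eAE phiB -eAE /eA rmorph_prod /gA big_mkcond /=.
by apply: eq_bigr => i _; case: ifP.
Qed.

Definition conj1 (R : realType) (n : nat) (l : 'I_n) (U : Kn0 R n) : Kn0 R n :=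
  \sum_(A : {set 'I_n}) (U A : R) *: (if l \in A then - eA R A else eA R A).

Definition conjB (R : realType) (n : nat) (B : {set 'I_n}) (U : Kn0 R n)
  : Kn0 R n :=
  foldr (@conj1 R n) U (enum B).

Definition f0 (R : realType) (n : nat) : Kn0 R n :=
  (2 ^+ n)^-1 *: \sum_(A : {set 'I_n}) eA R A.

Definition fB (R : realType) (n : nat) (B : {set 'I_n}) : Kn0 R n :=
  conjB B (f0 R n).

(* Subsets are compared as words: [enum A] lists A increasingly, and
   [seqlexi] carries the lexicographic order, in which a prefix comes
   first. *)
Definition lex_le (n : nat) (A B : {set 'I_n}) : bool :=
  ((enum A : seqlexi 'I_n) <= enum B)%O.

Definition subsets_lex (n : nat) : seq {set 'I_n} :=
  sort (@lex_le n) (enum {set 'I_n}).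

Lemma card_subsets (n : nat) : #|{set 'I_n}| = (2 ^ n)%N.
Proof. by rewrite -cardsT -powersetT card_powerset cardsT card_ord. Qed.

Lemma mem_subsets_lex (n : nat) (B : {set 'I_n}) : B \in subsets_lex n.
Proof. by rewrite mem_sort mem_enum. Qed.

Lemma size_subsets_lex (n : nat) : size (subsets_lex n) = (2 ^ n)%N.
Proof. by rewrite size_sort -cardE card_subsets. Qed.

Fact idx_proof (n : nat) (B : {set 'I_n}) : (index B (subsets_lex n) < 2 ^ n)%N.
Proof. by rewrite -size_subsets_lex index_mem mem_subsets_lex. Qed.

(* Positions are counted from 0: [idx B] is i(B) - 1. *)
Definition idx (n : nat) (B : {set 'I_n}) : 'I_(2 ^ n) := Ordinal (idx_proof B).

Lemma idx_bij (n : nat) : bijective (@idx n).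
Proof.
apply: inj_card_bij => [A B [AB]|]; last by rewrite card_ord card_subsets.
rewrite -(nth_index set0 (mem_subsets_lex A)) AB nth_index //.
exact: mem_subsets_lex.
Qed.

Lemma idx_set0 (n : nat) : idx (@set0 'I_n) = 0%N :> nat.
Proof.
have lt : total (@lex_le n) by move=> A B; apply: le_total.
have ltr : transitive (@lex_le n) by move=> A B C; apply: le_trans.
rewrite /=; have := sort_sorted lt (enum {set 'I_n}); rewrite -/(subsets_lex n).
have := mem_subsets_lex (@set0 'I_n).
case: (subsets_lex n) => // A s; rewrite inE eq_sym /=.
case: (eqVneq A set0) => [_ //|A0 /= sA].
move/(order_path_min ltr)/allP/(_ _ sA); rewrite /lex_le enum_set0.
have : enum A != [::] by rewrite -size_eq0 -cardE cards_eq0.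
by case: (enum A).
Qed.

(* Ring structure on [{ffun _ -> R^o}] is coordinatewise in the library. *)
Definition Rpow (R : realType) (n : nat) : Type := {ffun 'I_(2 ^ n) -> R^o}.

HB.instance Definition _ (R : realType) (n : nat) :=
  GRing.Lmodule.on (Rpow R n).
HB.instance Definition _ (R : realType) (n : nat) :=
  GRing.PzRing.on (Rpow R n).

Fact Rpow_one_neq0 (R : realType) (n : nat) : 1 != 0 :> Rpow R n.
Proof.
have n0 : (0 < 2 ^ n)%N by rewrite expn_gt0.
by apply/eqP => /ffunP/(_ (Ordinal n0))/eqP; rewrite !ffunE oner_eq0.
Qed.

HB.instance Definition _ (R : realType) (n : nat) :=
  GRing.PzSemiRing_isNonZero.Build (Rpow R n) (@Rpow_one_neq0 R n).

Fact Rpow_scaleAl (R : realType) (n : nat) (a : R) (u v : Rpow R n) :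
  a *: (u * v) = (a *: u) * v.
Proof. by apply/ffunP => k; rewrite !ffunE scalerAl. Qed.

HB.instance Definition _ (R : realType) (n : nat) :=
  GRing.Lmodule_isLalgebra.Build R (Rpow R n) (@Rpow_scaleAl R n).

Fact Rpow_scaleAr (R : realType) (n : nat) (a : R) (u v : Rpow R n) :
  a *: (u * v) = u * (a *: v).
Proof. by apply/ffunP => k; rewrite !ffunE scalerAr. Qed.

HB.instance Definition _ (R : realType) (n : nat) :=
  GRing.Lalgebra_isAlgebra.Build R (Rpow R n) (@Rpow_scaleAr R n).

Definition bvec (R : realType) (n : nat) (k : 'I_(2 ^ n)) : Rpow R n :=
  [ffun j => (j == k)%:R].

(* Main.v *)
Require Import Defs.
From HB Require Import structures.
From mathcomp Require Import all_boot all_order all_algebra.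
From mathcomp Require Import reals.
Import GRing.Theory.
Local Open Scope ring_scope.

(** The generators of K_{n,0} are commuting square roots of 1, so the algebra
    has one real character for each choice of signs e_i |-> +1 or -1, that is,
    for each subset B, where e_i |-> -1 exactly when i is in B.  These 2^n
    characters, collected in one tuple, form the isomorphism, and the f_B are
    the primitive idempotents dual to them.

    Expanding a product over the generators shows that
      f_B = \prod_i (1 + s_i(B) e_i) / 2    with s_i(B) = -1 iff i \in B
    ([fB_prod]), from which everything can be read off one factor at a time:
    - the character of C sends the i-th factor to (1 + s_i(B) s_i(C)) / 2,
      which is 0 as soon as B and C differ at i, so f_B goes to b_(i(B));
    - e_i f_B = s_i(B) f_B, so U f_B is the scalar chi_B(U) times f_B, where
      chi_B is the character of B ([mul_fB]);
    - expanding \prod_i ((1 + e_i)/2 + (1 - e_i)/2) = 1 gives \sum_B f_B = 1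
      ([sum_fB]).
    The last two facts give U = \sum_B chi_B(U) f_B: the tuple of characters
    has a left inverse, and a linear map is determined by its values on the
    f_B.  The inverse is two-sided since f_B goes to b_(i(B)). *)

Definition sgn (R : realType) (n : nat) (B : {set 'I_n}) (i : 'I_n) : R :=
  (-1) ^+ (i \in B).

Definition factor (R : realType) (n : nat) (B : {set 'I_n}) (i : 'I_n)
  : Kn0 R n :=
  2^-1 *: (1 + sgn R n B i *: gen R i).

Lemma conj1E (R : realType) (n : nat) (l : 'I_n) (U : Kn0 R n)
    (A : {set 'I_n}) :
  conj1 l U A = (-1) ^+ (l \in A) * U A.
Proof.
rewrite /conj1 sum_ffunE (bigD1 A) //= big1 ?addr0 => [|D /negbTE DA].
  by rewrite ffunE eAE; case: (l \in A); rewrite !ffunE eqxx mulrC.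
rewrite eAE; case: (l \in D); rewrite !ffunE eq_sym DA.
  by rewrite oppr0 scaler0.
by rewrite scaler0.
Qed.

Lemma conjBE (R : realType) (n : nat) (B : {set 'I_n}) (U : Kn0 R n)
    (A : {set 'I_n}) :
  conjB B U A = (\prod_(l in B) (-1) ^+ (l \in A)) * U A.
Proof.
rewrite /conjB -big_enum /=.
elim: (enum B) => [|l s IH] /=; first by rewrite big_nil mul1r.
by rewrite conj1E IH big_cons mulrA.
Qed.

(** Both sides have the coordinate (-1)^|A :&: B| / 2^n on e_A: conjugation
    produces it as a product over B, and the expansion as one over A. *)
Lemma fB_prod (R : realType) (n : nat) (B : {set 'I_n}) :
  fB R B = \prod_i factor R n B i.
Proof.
rewrite /factor scaler_prod prodr_const card_ord exprVn.
under eq_bigr => i _ do rewrite addrC.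
rewrite bigA_distr /= /fB.
have sumE : \sum_(A : {set 'I_n})
     \prod_i (if i \in A then sgn R n B i *: gen R i else 1)
   = \sum_(A : {set 'I_n}) (\prod_(i in A) sgn R n B i) *: eA R A.
  by apply: eq_bigr => A _; rewrite -big_mkcond scaler_prod.
have coefE (F : {set 'I_n} -> R) C : (\sum_A F A *: eA R A : Kn0 R n) C = F C.
  rewrite sum_ffunE (bigD1 C) //= big1 ?addr0 => [|D /negbTE DC].
    by rewrite eAE !ffunE eqxx [LHS]mulr1.
  by rewrite eAE !ffunE eq_sym DC scaler0.
rewrite sumE; apply/ffunP => A; rewrite conjBE /f0 ffunE [RHS]ffunE coefE.
have -> : (\sum_(D : {set 'I_n}) eA R D : Kn0 R n) A = 1.
  under eq_bigr => D _ do rewrite -[eA R D]scale1r.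
  exact: (coefE (fun=> 1)).
rewrite [_ *: 1]mulr1 mulrC; congr (_ * _).
rewrite big_mkcond [RHS]big_mkcond; apply: eq_bigr => i _ /=.
by rewrite /sgn; case: (i \in A); case: (i \in B).
Qed.

(** Summing over the two signs at each i gives (1 + e_i)/2 + (1 - e_i)/2. *)
Lemma sum_fB (R : realType) (n : nat) : \sum_B fB R B = 1 :> Kn0 R n.
Proof.
pose fac (b : bool) i : Kn0 R n := 2^-1 *: (1 + (-1) ^+ b *: gen R i).
transitivity (\prod_i (fac true i + fac false i)).
  rewrite bigA_distr; apply: eq_bigr => B _; rewrite fB_prod.
  by apply: eq_bigr => i _; rewrite /factor /sgn /fac; case: (i \in B).
apply: big1 => i _; rewrite /fac -scalerDr expr1 expr0 scaleN1r scale1r.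
rewrite addrACA addNr addr0 -mulr2n -scaler_nat scalerA.
by rewrite mulVf ?scale1r // Num.Theory.pnatr_eq0.
Qed.

Lemma gen_fB (R : realType) (n : nat) (B : {set 'I_n}) (i : 'I_n) :
  gen R i * fB R B = sgn R n B i *: fB R B.
Proof.
rewrite fB_prod (bigD1 i) //= mulrA scalerAl; congr (_ * _).
rewrite /factor -scalerAr scalerA [_ * 2^-1]mulrC -scalerA; congr (_ *: _).
rewrite mulrDr mulr1 -scalerAr gen_sq scalerDr scalerA.
by rewrite /sgn -expr2 sqrr_sign scale1r addrC.
Qed.

Lemma Rpow_prodE (R : realType) (n : nat) (I : finType) (P : pred I) (F : I -> Rpow R n)
    (k : 'I_(2 ^ n)) :
  (\prod_(i | P i) F i) k = \prod_(i | P i) (F i k : R).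
Proof.
apply: (big_morph (fun v : Rpow R n => v k : R)) => [u v|]; by rewrite ffunE.
Qed.

Section Characters.

Variables (R : realType) (n : nat) (phi : {lrmorphism Kn0 R n -> Rpow R n}).
Hypothesis phi_gen :
  forall (i : 'I_n) (B : {set 'I_n}), phi (gen R i) (idx B) = sgn R n B i.

(** Each f_B is a common eigenvector for multiplication by the generators,
    hence for multiplication by any U; the eigenvalue is the character. *)
Lemma mul_fB (U : Kn0 R n) (B : {set 'I_n}) :
  U * fB R B = (phi U (idx B) : R) *: fB R B.
Proof.
have eA_fB A : eA R A * fB R B = (\prod_(i in A) sgn R n B i) *: fB R B.
  rewrite /eA; elim/big_ind2: _ => [|a u b v Ha Hb|i _].
  - by rewrite mul1r scale1r.
  - by rewrite -mulrA Hb -scalerAr Ha scalerA mulrC.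
  - exact: gen_fB.
rewrite {1}(eA_decomp U) mulr_suml {2}(eA_decomp U) linear_sum sum_ffunE.
rewrite scaler_suml; apply: eq_bigr => A _.
rewrite -scalerAl eA_fB scalerA linearZ ffunE /= rmorph_prod Rpow_prodE.
by under [in RHS]eq_bigr => i _ do rewrite phi_gen.
Qed.

Lemma decomp_fB (U : Kn0 R n) : U = \sum_B (phi U (idx B) : R) *: fB R B.
Proof.
by rewrite -{1}[U]mulr1 -sum_fB mulr_sumr; apply: eq_bigr => B _; apply: mul_fB.
Qed.

(** If B and C differ at i, the i-th factor of f_B already vanishes at the
    position of C; otherwise every factor is 1 there. *)
Lemma phi_fB (B : {set 'I_n}) : phi (fB R B) = bvec R (idx B).
Proof.
have [idx' _ idxK] := idx_bij n; apply/ffunP => k; rewrite -(idxK k).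
move: (idx' k) => C; rewrite ffunE (bij_eq (idx_bij n)) fB_prod rmorph_prod.
rewrite Rpow_prodE.
have half2 : 2^-1 * (1 + 1) = 1 :> R.
  by rewrite mulVf // Num.Theory.pnatr_eq0.
have facE i : phi (factor R n B i) (idx C) = ((i \in C) == (i \in B))%:R :> R.
  rewrite linearZ ffunE linearD rmorph1 !ffunE linearZ ffunE phi_gen /sgn.
  rewrite /= -[_ *: _]/(_ * _) -[_ *: _]/(_ * _) -signr_addb.
  by case: (i \in C); case: (i \in B);
    rewrite /= ?expr0 ?expr1 ?subrr ?mulr0 ?half2.
under eq_bigr => i _ do rewrite facE.
have [->|CB] := eqVneq C B; first by apply: big1 => i _; rewrite eqxx.
have [i iCB] : exists i, (i \in C) != (i \in B).
  apply/existsP; apply: contraNT CB => /existsPn eqCB.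
  by apply/eqP/setP => i; apply/eqP/negPn/eqCB.
by rewrite (bigD1 i) //= (negbTE iCB) mul0r.
Qed.

Lemma phi_bij : bijective phi.
Proof.
exists (fun v : Rpow R n => \sum_B (v (idx B) : R) *: fB R B) => [U|v].
  by rewrite -decomp_fB.
have [idx' _ idxK] := idx_bij n; apply/ffunP => k; rewrite -(idxK k).
move: (idx' k) => C; rewrite linear_sum sum_ffunE (bigD1 C) //=.
rewrite linearZ ffunE /= phi_fB ffunE eqxx big1 ?addr0 => [|B BC].
  exact: mulr1.
rewrite linearZ ffunE /= phi_fB ffunE (bij_eq (idx_bij n)) eq_sym (negbTE BC).
exact: mulr0.
Qed.

End Characters.

(** The universal property of K_{n,0} provides the tuple of characters: the
    sign vectors of the generators square to 1 and commute. *)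
Theorem theorem6p5 (R : realType) (n : nat) :
  exists phi : {lrmorphism Kn0 R n -> Rpow R n},
    [/\ (forall B : {set 'I_n}, phi (fB R B) = bvec R (idx B)),
        bijective phi
      & forall psi : {linear Kn0 R n -> Rpow R n},
          (forall B : {set 'I_n}, psi (fB R B) = bvec R (idx B)) ->
          psi =1 phi].
Proof.
have [idx' idxK' idxK] := idx_bij n.
pose g (i : 'I_n) : Rpow R n := [ffun k => sgn R n (idx' k) i].
have gsq i : g i * g i = 1.
  by apply/ffunP => k; rewrite !ffunE /sgn -expr2 sqrr_sign.
have gC i j : g i * g j = g j * g i.
  by apply/ffunP => k; rewrite !ffunE mulrC.
have [phi [phig _]] := Kn0_presentation gsq gC.
have phi_gen i B : phi (gen R i) (idx B) = sgn R n B i.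
  by rewrite phig ffunE idxK'.
exists phi; split=> [B||psi psif U].
- exact: phi_fB.
- exact: phi_bij.
- rewrite (decomp_fB _ _ _ phi_gen U) !linear_sum; apply: eq_bigr => B _.
  by rewrite !linearZ /= psif (phi_fB _ _ _ phi_gen).
Qed.
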